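(* If $P\subseteq\mathbb{R}^3$ determines a single $\ell^1$-distance, then $|P|\le 6$. Further, $|P|=6$ if and only if $P$ is $\ell^1$-similar to $\Lambda_3(1)=\{\pm e_1,\pm e_2,\pm e_3\}$.
   Context: For $x\in\mathbb{R}^3$, $\|x\|_1=|x_1|+|x_2|+|x_3|$; a set determines the distance $\lambda$ if $\lambda=\|x-y\|_1$ for two distinct points $x,y$ of the set; ''determines a single distance'' means exactly one nonzero distance occurs. $e_1,e_2,e_3$ are the standard basis vectors. Two subsets of $\mathbb{R}^d$ are $\ell^1$-similar if one can be mapped to the other by a composition of translations, reflections about coordinate hyperplanes, dilations, and coordinate permutations. *)

(* Defs.v *)
From HB Require Import structures.
From mathcomp Require Export all_boot all_order all_algebra perm.
From mathcomp Require Export boolp classical_sets functions cardinality reals.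

Set Implicit Arguments.
Unset Strict Implicit.
Unset Printing Implicit Defensive.

Import Order.TTheory GRing.Theory Num.Theory.

Local Open Scope classical_set_scope.
Local Open Scope ring_scope.

(* The canonical norm of the library on 'rV[R]_d is the sup norm, hence this
   separate definition. *)
Definition l1norm (R : realType) (d : nat) (x : 'rV[R]_d) : R :=
  \sum_(i < d) `|x 0 i|.

Definition determines_distance (R : realType) (d : nat)
    (P : set 'rV[R]_d) (lambda : R) : Prop :=
  exists x y, [/\ P x, P y, x <> y & lambda = l1norm (x - y)].

Definition determines_single_distance (R : realType) (d : nat)
    (P : set 'rV[R]_d) : Prop :=
  exists! lambda : R, determines_distance P lambda.

Definition coord_reflection (R : realType) (d : nat) (i : 'I_d)
    (x : 'rV[R]_d) : 'rV[R]_d :=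
  \row_j (if j == i then - x 0 j else x 0 j).

Inductive l1_similarity (R : realType) (d : nat) :
    ('rV[R]_d -> 'rV[R]_d) -> Prop :=
| l1_sim_id : l1_similarity id
| l1_sim_translation (a : 'rV[R]_d) : l1_similarity (fun x => x + a)
| l1_sim_reflection (i : 'I_d) : l1_similarity (coord_reflection i)
| l1_sim_dilation (r : R) : 0 < r -> l1_similarity (fun x => r *: x)
| l1_sim_permutation (s : 'S_d) : l1_similarity (col_perm s)
| l1_sim_comp (f g : 'rV[R]_d -> 'rV[R]_d) :
    l1_similarity f -> l1_similarity g -> l1_similarity (f \o g).

Definition l1_similar (R : realType) (d : nat) (A B : set 'rV[R]_d) : Prop :=
  exists2 f, l1_similarity f & f @` A = B.

Definition Lambda3_1 (R : realType) : set 'rV[R]_3 :=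
  [set x | exists i : 'I_3, x = delta_mx 0 i \/ x = - delta_mx 0 i].

Arguments Lambda3_1 R : clear implicits.

(* Main.v *)
Require Import Defs.
From mathcomp Require Import finmap.
From mathcomp Require Import ring lra zify.

(* On a line, four points split into a lower and an upper pair, separated by a
   middle gap.  For four equidistant points the three ways of summing two
   complementary distances agree, which in R^3 forces the middle gaps in the
   three coordinates to be equal and, if nonzero, to realise the three possible
   splits once each.  Given a fifth point, take a quadruple a, b, d, e of maximal
   gap m > 0: comparing the gaps of the five quadruples shows that all the other
   gaps are m / 2, so the fifth point c lies between the two pairs in every
   coordinate; adding up the distances gives m = l (the common distance),
   whereas m <= l / 2 always holds.  Hence with at least five points all middle
   gaps vanish: each coordinate has a central value with at most one point
   strictly on either side.  Distances then add up through the center, every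
   point is at distance l / 2 from it, and choosing for each point a nonzero
   coordinate together with its sign is an injection into a set of 6 elements,
   whose surjectivity forces the octahedron. *)

Import Order.TTheory GRing.Theory Num.Theory.
Local Open Scope classical_set_scope.
Local Open Scope ring_scope.
Local Open Scope card_scope.
Set Implicit Arguments.
Unset Strict Implicit.
Unset Printing Implicit Defensive.

(** * Gaps of four and five points on a line *)

Section MiddleGap.
Variable R : realFieldType.
Implicit Types a b c d e m : R.

(* The middle gap: two of the three sums are equal and exceed the third by twice
   the gap between the second and third smallest of the numbers. *)
Definition gap4 a b c d : R :=
  let s1 := `|a - b| + `|c - d| in
  let s2 := `|a - c| + `|b - d| in
  let s3 := `|a - d| + `|b - c| in
  (`|s1 - s2| + `|s1 - s3| + `|s2 - s3|) / 4.

(** The inequalities are weak, so ties may make several of the three splits separated at once. *)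
Definition separated a b c d : bool :=
  [&& a <= c, a <= d, b <= c & b <= d] || [&& c <= a, c <= b, d <= a & d <= b].

Lemma gap4_ge0 a b c d : 0 <= gap4 a b c d.
Proof. by rewrite divr_ge0 // !addr_ge0. Qed.

Lemma gap4_swap12 a b c d : gap4 a b c d = gap4 b a c d.
Proof.
rewrite /gap4 [ `|b - a|]distrC [ `|b - d| + _]addrC [ `|b - c| + _]addrC.
by rewrite [ `|_ + `|b - c| - _|]distrC; congr (_ / _); ring.
Qed.

Lemma gap4_swap34 a b c d : gap4 a b c d = gap4 a b d c.
Proof.
rewrite /gap4 [ `|d - c|]distrC.
by rewrite [ `|_ + `|b - c| - _|]distrC; congr (_ / _); ring.
Qed.

Lemma gap4_swap23 a b c d : gap4 a b c d = gap4 a c b d.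
Proof.
rewrite /gap4 [ `|c - b|]distrC.
by rewrite [ `|_ + `|c - d| - (_ + `|b - d|)|]distrC; congr (_ / _); ring.
Qed.

Lemma gap4N a b c d : gap4 (- a) (- b) (- c) (- d) = gap4 a b c d.
Proof. by rewrite /gap4 -!opprD !normrN. Qed.

Lemma gap4_sorted a b c d :
  a <= b -> b <= c -> c <= d -> gap4 a b c d = c - b.
Proof.
move=> ab bc cd; rewrite /gap4.
have -> : `|a - b| = b - a by rewrite ler0_norm; lra.
have -> : `|c - d| = d - c by rewrite ler0_norm; lra.
have -> : `|a - c| = c - a by rewrite ler0_norm; lra.
have -> : `|b - d| = d - b by rewrite ler0_norm; lra.
have -> : `|a - d| = d - a by rewrite ler0_norm; lra.
have -> : `|b - c| = c - b by rewrite ler0_norm; lra.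
rewrite !ler0_norm; lra.
Qed.

Lemma separated_swap12 a b c d : separated a b c d = separated b a c d.
Proof. by rewrite /separated; do !case: (_ <= _). Qed.

Lemma separated_swap34 a b c d : separated a b c d = separated a b d c.
Proof. by rewrite /separated; do !case: (_ <= _). Qed.

Lemma separated_sym a b c d : separated a b c d = separated c d a b.
Proof. by rewrite /separated; do !case: (_ <= _). Qed.

(** Insertion sort: the three adjacent transpositions reduce a claim about four numbers to the
    sorted case. *)
Lemma sorted4_ind (Q : R -> R -> R -> R -> Prop) :
  (forall a b c d, Q a b c d -> Q b a c d) ->
  (forall a b c d, Q a b c d -> Q a c b d) ->
  (forall a b c d, Q a b c d -> Q a b d c) ->
  (forall a b c d, a <= b -> b <= c -> c <= d -> Q a b c d) ->
  forall a b c d, Q a b c d.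
Proof.
move=> Q12 Q23 Q34 Qs.
have Q3 a b c d : b <= c -> c <= d -> Q a b c d.
  move=> bc cd; case: (leP a b) => [ab|/ltW ba]; first exact: Qs.
  apply: Q12; case: (leP a c) => [ac|/ltW ca]; first exact: Qs.
  apply: Q23; case: (leP a d) => [ad|/ltW da]; first exact: Qs.
  by apply: Q34; apply: Qs.
have Q2 a b c d : c <= d -> Q a b c d.
  move=> cd; case: (leP b c) => [bc|/ltW cb]; first exact: Q3.
  apply: Q23; case: (leP b d) => [bd|/ltW db]; first exact: Q3.
  by apply: Q34; apply: Q3.
move=> a b c d; case: (leP c d) => [cd|/ltW dc]; first exact: Q2.
by apply: Q34; apply: Q2.
Qed.

Lemma separated_total a b c d :
  [\/ separated a b c d, separated a c b d | separated a d b c].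
Proof.
move: a b c d; apply: sorted4_ind => a b c d.
- rewrite (separated_sym b c) (separated_sym b d) (separated_swap12 b).
  by case; [apply: Or31|apply: Or33|apply: Or32].
- rewrite (separated_swap34 a d c).
  by case; [apply: Or32|apply: Or31|apply: Or33].
- rewrite (separated_swap34 a b d).
  by case; [apply: Or31|apply: Or33|apply: Or32].
by move=> ab bc cd; apply: Or31; rewrite /separated; lra.
Qed.

(** In either cross pairing both segments run across the middle gap, which is therefore counted
    twice on top of the two inner distances. *)
Lemma gap4_separated a b c d : separated a b c d ->
  let s := `|a - b| + `|c - d| + 2 * gap4 a b c d in
  `|a - c| + `|b - d| = s /\ `|a - d| + `|b - c| = s.
Proof.
wlog abcd : a b c d / [&& a <= c, a <= d, b <= c & b <= d].
  move=> hw /orP[h|/and4P[? ? ? ?]]; first by apply: hw; rewrite ?/separated h.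
  have := hw (- a) (- b) (- c) (- d).
  rewrite !gap4N -!opprD !normrN !lerN2 /separated !lerN2.
  by apply; lra.
move=> _; case/and4P: abcd.
wlog ab : a b / a <= b.
  move=> hw; case: (leP a b) => [|/ltW ba]; first exact: hw.
  move=> ac ad bc bd /=; rewrite gap4_swap12 (distrC a b).
  by have [] := hw b a ba bc bd ac ad; split; lra.
wlog cd : c d / c <= d.
  move=> hw; case: (leP c d) => [|/ltW dc]; first exact: hw.
  move=> ac ad bc bd /=; rewrite gap4_swap34 (distrC c d).
  by have [] := hw d c dc ad ac bd bc; split; lra.
move=> ac ad bc bd /=; rewrite gap4_sorted //.
by split; rewrite !ler0_norm; lra.
Qed.

Lemma gap4_split a b c d :
  let s1 := `|a - b| + `|c - d| in
  let s2 := `|a - c| + `|b - d| in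
  let s3 := `|a - d| + `|b - c| in
  let g := gap4 a b c d in
  [\/ [/\ separated a b c d, s2 = s1 + 2 * g & s3 = s1 + 2 * g],
      [/\ separated a c b d, s1 = s2 + 2 * g & s3 = s2 + 2 * g] |
      [/\ separated a d b c, s1 = s3 + 2 * g & s2 = s3 + 2 * g]].
Proof.
case: (separated_total a b c d) => /[dup] sep /gap4_separated /= [h1 h2].
- by apply: Or31.
- by apply: Or32; rewrite gap4_swap23 (distrC b c).
- apply: Or33; rewrite gap4_swap34 gap4_swap23 (distrC c d) h1.
  by rewrite -h2 (distrC d b).
Qed.

(** When [c] lies in the middle interval, [t] is its distance to the nearer of [d] and [e]. When [c]
    lies outside, the bounds by [m] force [t] to be 0 or [m]. So [0 < t < m] puts [c] strictly
    between the pairs, where its distances to the four points telescope. *)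
Lemma gap4_fifth_point a b c d e (m := gap4 a b d e) :
    separated a b d e ->
    gap4 b c d e <= m -> gap4 a c d e <= m ->
    gap4 a b c e <= m -> gap4 a b c d <= m ->
  exists t, [/\ gap4 b c d e = t, gap4 a c d e = t,
    gap4 a b c e = m - t, gap4 a b c d = m - t &
    0 < t < m ->
      `|c - a| + `|c - b| + `|c - d| + `|c - e| = `|a - d| + `|b - e|].
Proof.
rewrite /m {m}.
wlog abde : a b c d e / [&& a <= d, a <= e, b <= d & b <= e].
  move=> hw /[dup] sep; rewrite {1}/separated => /orP[le|/and4P[da db ea eb]].
    exact: hw.
  move=> h1 h2 h3 h4; have := hw (- a) (- b) (- c) (- d) (- e).
  rewrite !gap4N -!opprD !normrN !lerN2 da db ea eb /separated !lerN2.
  by rewrite da db ea eb; apply.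
move=> _; case/and4P: abde.
wlog ab : a b / a <= b.
  move=> hw; case: (leP a b) => [|/ltW ba]; first exact: hw.
  move=> ad ae bd be; rewrite ![gap4 a b _ _]gap4_swap12 => h1 h2 h3 h4.
  have [t [t1 t2 t3 t4 t5]] := hw b a ba bd be ad ae h2 h1 h3 h4.
  exists t; split=> // /t5.
  rewrite [ `|a - d|]ler0_norm ?[ `|b - e|]ler0_norm; try lra.
  rewrite [ `|a - e|]ler0_norm ?[ `|b - d|]ler0_norm; lra.
wlog de : d e / d <= e.
  move=> hw; case: (leP d e) => [|/ltW ed]; first exact: hw.
  move=> ad ae bd be; rewrite ![gap4 _ _ d e]gap4_swap34 => h1 h2 h3 h4.
  have [t [t1 t2 t3 t4 t5]] := hw e d ed ae ad be bd h1 h2 h4 h3.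
  exists t; split=> // /t5.
  rewrite [ `|a - d|]ler0_norm ?[ `|b - e|]ler0_norm; try lra.
  rewrite [ `|a - e|]ler0_norm ?[ `|b - d|]ler0_norm; lra.
move=> ad ae bd be; rewrite (@gap4_sorted a b d e) //.
case: (leP c b) => [cb|/ltW bc].
  rewrite (gap4_swap12 b) (@gap4_sorted c b d e) //.
  case: (leP a c) => [ac|/ltW ca].
    rewrite (@gap4_sorted a c d e) //; last lra.
    rewrite !(gap4_swap23 a b) !(@gap4_sorted a c b) //.
    by move=> ? ? ? ?; exists (d - b); split; lra.
  rewrite !(gap4_swap23 a b) !(gap4_swap12 a c).
  rewrite (@gap4_sorted c a d) // !(@gap4_sorted c a b) //.
  by move=> ? ? ? ?; exists (d - b); split; lra.
case: (leP c d) => [cd|/ltW dc].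
  rewrite !gap4_sorted //; try lra.
  move=> ? ? ? ?; exists (d - c); split; try lra.
  move=> _; rewrite [ `|c - a|]ger0_norm; last lra.
  rewrite [ `|c - b|]ger0_norm; last lra.
  by rewrite !ler0_norm; lra.
rewrite !(gap4_swap23 _ c d) (gap4_swap34 a b c d) (@gap4_sorted a b d c) //.
case: (leP c e) => [ce|/ltW ec].
  rewrite (@gap4_sorted a b c e) // !gap4_sorted //.
  by move=> ? ? ? ?; exists (c - d); split; lra.
rewrite !(gap4_swap34 _ _ c e) !gap4_sorted //.
by move=> ? ? ? ?; exists (e - d); split; lra.
Qed.

End MiddleGap.

(** * Vanishing of the gaps of equidistant points *)

Section Equidistant.
Variables (R : realFieldType) (T : finType) (l : R).
Implicit Types x y z : T -> R.
Implicit Types p q r s : T.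

Definition equidistant3 x y z :=
  forall p q, p != q -> `|x p - x q| + `|y p - y q| + `|z p - z q| = l.

Definition gap x p q r s := gap4 (x p) (x q) (x r) (x s).

Lemma equidistant3_rotate x y z : equidistant3 x y z -> equidistant3 y z x.
Proof. by move=> E p q /E; rewrite -addrA addrC. Qed.

Lemma equidistant3_swap x y z : equidistant3 x y z -> equidistant3 y x z.
Proof. by move=> E p q /E; rewrite [ `|x _ - _| + _]addrC. Qed.

(* The three ways of pairing up four equidistant points give the same sum of
   distances, so each of the three splits has the same total weight. *)
Lemma gap_coord x y z p q r s :
  equidistant3 x y z -> uniq [:: p; q; r; s] -> gap x p q r s = gap y p q r s.
Proof.
move=> E /=; rewrite !inE !negb_or.
move=> /and4P[/and3P[pq pr ps] /andP[qr qs] rs _].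
move: (E _ _ pq) (E _ _ pr) (E _ _ ps) (E _ _ qr) (E _ _ qs) (E _ _ rs).
have := gap4_ge0 (x p) (x q) (x r) (x s).
have := gap4_ge0 (y p) (y q) (y r) (y s).
have := gap4_ge0 (z p) (z q) (z r) (z s).
rewrite -!/(gap _ _ _ _ _).
case: (gap4_split (x p) (x q) (x r) (x s)) => -[_].
all: case: (gap4_split (y p) (y q) (y r) (y s)) => -[_].
all: case: (gap4_split (z p) (z q) (z r) (z s)) => -[_].
all: by rewrite -!/(gap _ _ _ _ _); clear; lra.
Qed.

(** The contradiction comes from applying [gap4_fifth_point] to [c] in every coordinate, each with
    its own split of [a], [b], [d], [e]. *)
Lemma max_gap_split x y z a b c d e (m := gap x a b d e) :
    equidistant3 x y z -> uniq [:: a; b; c; d; e] ->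
    (forall p q r s, uniq [:: p; q; r; s] -> gap x p q r s <= m) ->
    separated (x a) (x b) (x d) (x e) ->
    separated (y a) (y d) (y b) (y e) ->
    separated (z a) (z e) (z b) (z d) ->
  m <= 0.
Proof.
move=> E U M Sx Sy Sz; rewrite leNgt; apply/negP => m_gt0.
have Exzy := equidistant3_swap (equidistant3_rotate (equidistant3_rotate E)).
have Fy p q r s : uniq [:: p; q; r; s] -> gap y p q r s = gap x p q r s.
  by move=> /(gap_coord E).
have Fz p q r s : uniq [:: p; q; r; s] -> gap z p q r s = gap x p q r s.
  by move=> /(gap_coord Exzy).
have : uniq [:: a; b; c; d; e] by [].
rewrite /= !inE !negb_or => /and5P[].
move=> /and4P[ab ac ad ae] /and3P[bc bd be] /andP[cd ce] de _.
have Ua : uniq [:: b; c; d; e].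
  by rewrite /= !inE !negb_or bc bd be cd ce de.
have Ub : uniq [:: a; c; d; e].
  by rewrite /= !inE !negb_or ac ad ae cd ce de.
have Uc : uniq [:: a; b; d; e].
  by rewrite /= !inE !negb_or ab ad ae bd be de.
have Ud : uniq [:: a; b; c; e].
  by rewrite /= !inE !negb_or ab ac ae bc be ce.
have Ue : uniq [:: a; b; c; d].
  by rewrite /= !inE !negb_or ab ac ad bc bd cd.
have xc : gap x a b d e = m by [].
(* The quadruples of [y] and [z] are listed in the order in which [gap4_fifth_point] meets them for
   the new split; their gaps are those of [x]. *)
have ya : gap y d c b e = gap x b c d e.
  by rewrite -Fy // /gap gap4_swap12 gap4_swap23 gap4_swap12.
have yb : gap y a d c e = gap x a c d e.
  by rewrite -Fy // /gap gap4_swap23.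
have yc : gap y a d b e = m.
  by rewrite /m -Fy // /gap gap4_swap23.
have yd : gap y a c b e = gap x a b c e.
  by rewrite -Fy // /gap gap4_swap23.
have ye : gap y a d c b = gap x a b c d.
  by rewrite -Fy // /gap gap4_swap34 gap4_swap23 gap4_swap34 gap4_swap23.
have za : gap z e c b d = gap x b c d e.
  by rewrite -Fz // /gap gap4_swap12 gap4_swap23 gap4_swap34 gap4_swap12.
have zb : gap z a e c d = gap x a c d e.
  by rewrite -Fz // /gap gap4_swap23 gap4_swap34.
have zc : gap z a e b d = m.
  by rewrite /m -Fz // /gap gap4_swap23 gap4_swap34.
have zd : gap z a e c b = gap x a b c e.
  by rewrite -Fz // /gap gap4_swap34 gap4_swap23 gap4_swap34 gap4_swap23.
have ze : gap z a c b d = gap x a b c d.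
  by rewrite -Fz // /gap gap4_swap23.
have Ma := M _ _ _ _ Ua; have Mb := M _ _ _ _ Ub.
have Md := M _ _ _ _ Ud; have Me := M _ _ _ _ Ue.
have [tx] := gap4_fifth_point Sx Ma Mb Md Me.
rewrite -!/(gap _ _ _ _ _) xc => -[xa1 xb1 xd1 xe1 xin].
have [||||ty] := @gap4_fifth_point _ (y a) (y d) (y c) (y b) (y e) Sy.
1-4: by rewrite -!/(gap _ _ _ _ _) ?(ya, yb, yc, yd, ye).
rewrite -!/(gap _ _ _ _ _) ya yb yc yd ye => -[ya1 yd1 yb1 ye1 yin].
have [||||tz] := @gap4_fifth_point _ (z a) (z e) (z c) (z b) (z d) Sz.
1-4: by rewrite -!/(gap _ _ _ _ _) ?(za, zb, zc, zd, ze).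
rewrite -!/(gap _ _ _ _ _) za zb zc zd ze => -[za1 ze1 zb1 zd1 zin].
have [+ _] := gap4_separated Sx; have [+ _] := gap4_separated Sy.
have [+ _] := gap4_separated Sz => /=.
rewrite -!/(gap _ _ _ _ _) xc yc zc => Gz Gy Gx.
clearbody m.
(* Comparing the gaps gives [tx = ty = m - ty] and [tz = tx], so all three equal [m / 2], strictly
   between 0 and [m]. *)
have {}xin := xin ltac:(lra); have {}yin := yin ltac:(lra).
have {}zin := zin ltac:(lra).
(* The distances from [c] add up to [4 l = 2 l + 2 m], so [m = l]. The gaps in [y] and [z] alone
   contribute [4 m] to the distances [a b] and [d e], whose sum is [2 l]. *)
have := E _ _ ab; have := E _ _ de; have := E _ _ cd; have := E _ _ ce.
have := E c a; rewrite eq_sym => /(_ ac).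
have := E c b; rewrite eq_sym => /(_ bc).
rewrite (distrC (z e) (z d)) in zin Gz.
move: (normr_ge0 (x a - x b)) (normr_ge0 (x d - x e)).
move: (normr_ge0 (y a - y d)) (normr_ge0 (y b - y e)).
move: (normr_ge0 (z a - z e)) (normr_ge0 (z b - z d)).
move: m_gt0 xin yin zin Gx Gy Gz; clear; lra.
Qed.

Lemma gap_eq0 x y z : (4 < #|T|)%N -> equidistant3 x y z ->
  forall p q r s, uniq [:: p; q; r; s] -> gap x p q r s = 0.
Proof.
move=> T_gt4 E p0 q0 r0 s0 U0.
pose U (t : T * T * T * T) := uniq [:: t.1.1.1; t.1.1.2; t.1.2; t.2].
pose F (t : T * T * T * T) := gap x t.1.1.1 t.1.1.2 t.1.2 t.2.
have [[[[p q] r] s]] := @arg_maxP _ R _ (p0, q0, r0, s0) U F U0.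
rewrite /U /F /= => Upqrs M.
apply/eqP; rewrite eq_le gap4_ge0 andbT.
apply: le_trans (M (p0, q0, r0, s0) U0) _.
have {}M p' q' r' s' : uniq [:: p'; q'; r'; s'] ->
    gap x p' q' r' s' <= gap x p q r s.
  by move=> U'; exact: (M (p', q', r', s')).
have [c Uc] : exists c, c \notin [:: p; q; r; s].
  apply/existsP; apply/contraLR: T_gt4; rewrite negb_exists => /forallP T4.
  rewrite -leqNgt; apply: leq_trans (card_size [:: p; q; r; s]).
  by apply/subset_leq_card/fintype.subsetP => c _; have := T4 c; rewrite negbK.
have Exzy := equidistant3_swap (equidistant3_rotate (equidistant3_rotate E)).
have Fy := gap_coord E; have Fz := gap_coord Exzy.
(* The extra point takes the third place, as in [max_gap_split]. *)
have U5 : uniq [:: p; q; c; r; s].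
  rewrite (perm_uniq (_ : perm_eq _ (c :: [:: p; q; r; s]))) /= ?Uc //.
  by rewrite (perm_catCA [:: p; q] [:: c]).
rewrite leNgt; apply/negP => m_gt0.
(* The coordinates [u], [v], [w] may be any reordering of [x], [y], [z], so that each split can
   occur in any coordinate. *)
have core u v w : equidistant3 u v w ->
    (forall p q r s, uniq [:: p; q; r; s] -> gap x p q r s = gap u p q r s) ->
    separated (u p) (u q) (u r) (u s) -> separated (v p) (v r) (v q) (v s) ->
    separated (w p) (w s) (w q) (w r) -> False.
  move=> Euvw Fu Su Sv Sw; have := max_gap_split Euvw U5 _ Su Sv Sw.
  rewrite -Fu // leNgt m_gt0 => h; apply: notF; apply: h => p' q' r' s' U'.
  by rewrite -!Fu // M.
have Eyxz := equidistant3_swap E.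
have Eyzx := equidistant3_rotate E; have Ezxy := equidistant3_rotate Eyzx.
have Ezyx := equidistant3_swap Eyzx.
have := Upqrs; rewrite /= !inE !negb_or.
move=> /and4P[/and3P[pq pr ps] /andP[qr qs] rs _].
move: (E _ _ pq) (E _ _ pr) (E _ _ ps) (E _ _ qr) (E _ _ qs) (E _ _ rs).
have Fyp := Fy _ _ _ _ Upqrs; have Fzp := Fz _ _ _ _ Upqrs.
case: (gap4_split (x p) (x q) (x r) (x s)) => -[Sx] /=.
all: case: (gap4_split (y p) (y q) (y r) (y s)) => -[Sy] /=.
all: case: (gap4_split (z p) (z q) (z r) (z s)) => -[Sz] /=.
all: rewrite -!/(gap _ _ _ _ _).
(* Of the 27 combinations, six use every split once and fall to [core]; a repeated split contradicts
   the equal sums of distances when the gap is positive. *)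
all: first [by move=> *; apply: (core x y z) | by move=> *; apply: (core x z y)
  | by move=> *; apply: (core y x z) | by move=> *; apply: (core y z x)
  | by move=> *; apply: (core z x y) | by move=> *; apply: (core z y x)
  | move: m_gt0 Fyp Fzp; clear; lra].
Qed.

(** The center is the second smallest value [x p1]. Only [p0] can lie strictly below it, and two
    points strictly above would form with [p0] and [p1] a quadruple of positive gap. *)
Lemma gap_center x : (1 < #|T|)%N ->
    (forall p q r s, uniq [:: p; q; r; s] -> gap x p q r s = 0) ->
  exists c, forall p q, p != q -> (x p - c) * (x q - c) <= 0.
Proof.
move=> T_gt1 G.
have [t0 _] : exists t : T, t \in T by apply/card_gt0P/(leq_trans _ T_gt1).
have [p0 _ p0_min] := @arg_minP _ R _ t0 xpredT x isT.
have [t1 t1p0] : exists t, t != p0.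
  have : (0 < #|predC1 p0|)%N by have := cardC1 p0; lia.
  by case/card_gt0P => t; rewrite inE => ?; exists t.
have [p1 p10 p1_min] := @arg_minP _ R _ t1 (fun t => t != p0) x t1p0.
have low p : p != p0 -> x p1 <= x p by exact: p1_min.
have high p q : p != q -> x p <= x q -> x p1 < x p -> False.
  move=> pq xpq lt_p1p.
  have lt_p0p : x p0 < x p by exact: le_lt_trans (p0_min p1 isT) _.
  have ne u v : x u < x v -> u != v by apply: contraTneq => ->; rewrite ltxx.
  have := G p0 p1 p q; rewrite /= !inE !negb_or pq eq_sym p10 !ne //;
    last 2 first.
  - exact: lt_le_trans xpq.
  - exact: lt_le_trans xpq.
  move=> /(_ isT); rewrite /gap gap4_sorted ?(ltW lt_p1p) //; last exact: p0_min.
  lra.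
exists (x p1) => p q pq; rewrite leNgt; apply/negP.
have [xp|xp] := ltP (x p) (x p1); have [xq|xq] := ltP (x q) (x p1).
- have [pp0|/low] := eqVneq p p0; last lra.
  have [qp0|/low] := eqVneq q p0; last lra.
  by rewrite pp0 qp0 eqxx in pq.
- by rewrite ltNge mulr_le0_ge0 //; lra.
- by rewrite ltNge mulr_ge0_le0 //; lra.
move=> pos.
have {}xp : x p1 < x p.
  by rewrite lt_neqAle xp andbT; apply/contraTneq: pos => ->;
    rewrite subrr mul0r ltxx.
have {}xq : x p1 < x q.
  by rewrite lt_neqAle xq andbT; apply/contraTneq: pos => ->;
    rewrite subrr mulr0 ltxx.
have [pq_le|/ltW qp_le] := leP (x p) (x q); first exact: high pq pq_le xp.
by apply: high qp_le xq; rewrite eq_sym.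
Qed.

End Equidistant.

(** * Coordinates, absolute values and signs *)

Lemma ord3_ind (Q : 'I_3 -> Prop) : Q 0 -> Q 1 -> Q 2 -> forall i, Q i.
Proof.
move=> Q0 Q1 Q2 [[|[|[|//]]] lt_i].
- by rewrite (_ : Ordinal lt_i = 0) //; apply: val_inj.
- by rewrite (_ : Ordinal lt_i = 1) //; apply: val_inj.
- by rewrite (_ : Ordinal lt_i = 2) //; apply: val_inj.
Qed.

Lemma l1norm3E (R : realType) (x : 'rV[R]_3) :
  l1norm x = `|x 0 0| + `|x 0 1| + `|x 0 2|.
Proof.
rewrite /l1norm !big_ord_recl big_ord0 addr0 addrA.
by congr (`|x _ _| + `|x _ _| + `|x _ _|); apply: val_inj.
Qed.

Lemma distr_opp_sign (R : realDomainType) (u v : R) :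
  u * v <= 0 -> `|u - v| = `|u| + `|v|.
Proof.
move=> uv; have [u0|u0] := leP 0 u; have [v0|v0] := leP 0 v.
- have /eqP : u * v == 0 by rewrite eq_le uv mulr_ge0.
  move=> /eqP; rewrite mulf_eq0 => /orP[]/eqP->.
    by rewrite sub0r normrN normr0 add0r.
  by rewrite subr0 normr0 addr0.
- by rewrite (ger0_norm u0) (ltr0_norm v0) ger0_norm; lra.
- by rewrite (ltr0_norm u0) (ger0_norm v0) ler0_norm; lra.
- by move: uv; rewrite leNgt nmulr_rgt0 ?v0.
Qed.

Lemma sub_norm_sign (R : realFieldType) (u w t : R) :
  `|u - w| = t -> u = w + t * (-1) ^+ (u - w < 0)%R.
Proof.
case: ltP => s; first by rewrite ltr0_norm // expr1; lra.
by rewrite ger0_norm // expr0; lra.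
Qed.

(** The boolean marks the negative vertices, so a sign test [_ < 0] can serve directly as the second
    component. *)
Definition octahedron_vertex (R : realType) (t : 'I_3 * bool) : 'rV[R]_3 :=
  (-1) ^+ t.2 *: delta_mx 0 t.1.

(** * The center and the octahedron of an equilateral family *)

Section Octahedron.
Variables (R : realType) (T : finType) (l : R) (v : T -> 'rV[R]_3).
Hypothesis l_gt0 : 0 < l.
Hypothesis v_dist : forall p q, p != q -> l1norm (v p - v q) = l.
Hypothesis T_gt4 : (4 < #|T|)%N.

Lemma equilateral_center : exists c : 'rV[R]_3,
  (forall p, l1norm (v p - c) = l / 2) /\
  forall i p q, p != q -> (v p - c) 0 i * (v q - c) 0 i <= 0.
Proof.
pose x i p := v p 0 i.
have E : equidistant3 l (x 0) (x 1) (x 2).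
  by move=> p q /v_dist; rewrite l1norm3E !mxE.
have E1 := equidistant3_rotate E; have E2 := equidistant3_rotate E1.
have center_i i :
    exists c, forall p q, p != q -> (x i p - c) * (x i q - c) <= 0.
  apply: gap_center; first exact: leq_trans T_gt4.
  by move: i; apply: ord3_ind; apply: gap_eq0; eassumption.
have [c cP] := choice center_i.
exists (\row_i c i).
have opp i p q : p != q -> (v p - \row_i c i) 0 i * (v q - \row_i c i) 0 i <= 0.
  by move=> pq; rewrite !mxE; apply: cP.
split=> //.
have add p q : p != q ->
    l1norm (v p - \row_i c i) + l1norm (v q - \row_i c i) = l.
  move=> pq; rewrite -(v_dist pq) /l1norm -big_split /=.
  apply: eq_bigr => i _; rewrite -(distr_opp_sign (opp i _ _ pq)).
  by congr `|_|; rewrite !mxE; ring.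
move=> p.
(* Two further points suffice: three norms whose pairwise sums are all [l] equal [l / 2]. *)
have : (1 < #|predC1 p|)%N by have := cardC1 p; lia.
case/card_gt1P => q [r []]; rewrite !inE => qp rp qr.
have := add _ _ qp; have := add _ _ rp; have := add _ _ qr; lra.
Qed.

Lemma equilateral_octahedron : exists c : 'rV[R]_3,
  exists2 phi : T -> 'I_3 * bool, injective phi &
  #|T| = 6%N -> forall p, v p = c + (l / 2) *: octahedron_vertex R (phi p).
Proof.
have [c [c_norm c_opp]] := equilateral_center.
have nz p : exists i, (v p - c) 0 i != 0.
  apply/existsP; apply/contraT; rewrite negb_exists => /forallP h.
  have : 0 < l1norm (v p - c) by rewrite c_norm divr_gt0.
  rewrite /l1norm big1 ?ltxx // => i _.
  by have := h i; rewrite negbK => /eqP->; rewrite normr0.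
have [k kP] := choice nz.
pose phi p := (k p, (v p - c) 0 (k p) < 0).
(* Distinct points cannot share a nonzero coordinate of equal sign, since the product would be
   positive. *)
have sgn i p q : (v p - c) 0 i != 0 -> (v q - c) 0 i != 0 ->
    ((v p - c) 0 i < 0) = ((v q - c) 0 i < 0) -> p = q.
  move=> p0 q0 s; apply/eqP/contraT => /(c_opp i).
  move: s p0 q0; set a := _ 0 i; set b := _ 0 i.
  case: (ltgtP b 0) => // b0; case: (ltgtP a 0) => // a0 _ _ _.
    by rewrite leNgt nmulr_rgt0 ?b0.
  by rewrite leNgt mulr_gt0.
have phi_inj : injective phi.
  move=> p q [kpq s]; apply: (sgn (k q)) (kP q) _; first by rewrite -kpq kP.
  by rewrite -s kpq.
exists c, phi => // T6 p.
have phi_bij : bijective phi.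
  by apply: inj_card_bij => //; rewrite card_prod card_ord card_bool T6.
(* Surjectivity: if coordinate [j] of [p] were nonzero, the pair of [j] and its sign would be
   [phi q] for some [q]; then [p = q] by [sgn], hence [j = k p]. *)
have off j : j != k p -> (v p - c) 0 j = 0.
  apply: contra_neq_eq => pj.
  have [psi _ phiK] := phi_bij.
  have := phiK (j, (v p - c) 0 j < 0); set q := psi _ => -[kq sq].
  suff -> : p = q by [].
  apply: (sgn j) pj _ _; first by rewrite -kq kP.
  by rewrite -sq kq.
apply/rowP => j; rewrite /octahedron_vertex !mxE eqxx /=.
have := c_norm p; rewrite /l1norm (bigD1 (k p)) //= big1 ?addr0; last first.
  by move=> i /off ->; rewrite normr0.
have [-> |jk] := eqVneq j (k p).
  by rewrite mulr1 !mxE => /sub_norm_sign.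
by move=> _; have := off j jk; rewrite !mxE !mulr0 addr0 => /subr0_eq.
Qed.

End Octahedron.

(** * Single distances, similarities and the six vertices *)

Lemma l1norm_eq0 (R : realType) (d : nat) (x : 'rV[R]_d) :
  l1norm x = 0 -> x = 0.
Proof.
move=> /psumr_eq0P x0; apply/rowP => i; rewrite mxE; apply/normr0_eq0.
by apply: x0.
Qed.

Lemma single_distance_gt0 (R : realType) (d : nat) (P : set 'rV[R]_d) :
  determines_single_distance P ->
  exists2 l, 0 < l & forall x y, P x -> P y -> x != y -> l1norm (x - y) = l.
Proof.
move=> [l [[x [y [Px Py xy lE]]] l_uniq]]; exists l.
  rewrite lt_neqAle lE sumr_ge0 // andbT eq_sym.
  by apply/eqP => /l1norm_eq0/subr0_eq.
by move=> x' y' Px' Py' /eqP xy'; apply/esym/l_uniq; exists x', y'.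
Qed.

(** Injectivity carries the cardinality of the octahedron back to any set similar to it. *)
Lemma l1_similarity_inj (R : realType) (d : nat) (f : 'rV[R]_d -> 'rV[R]_d) :
  l1_similarity f -> injective f.
Proof.
elim=> {f} [|a|i|r r_gt0|s|f g _ f_inj _ g_inj] //.
- exact: addIr.
- move=> x y /rowP xy; apply/rowP => j; have := xy j; rewrite !mxE.
  by case: ifP => // _ /oppr_inj.
- by apply: scalerI; rewrite gt_eqF.
- move=> x y /rowP xy; apply/rowP => j; have := xy (s^-1%g j).
  by rewrite !mxE permKV.
- exact: inj_comp.
Qed.

Lemma Lambda3_1E (R : realType) : Lambda3_1 R = range (@octahedron_vertex R).
Proof.
apply/seteqP; split=> [x [i [->|->]]|x [[i b] _ <-]].
- by exists (i, false) => //; rewrite /octahedron_vertex scale1r.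
- by exists (i, true) => //; rewrite /octahedron_vertex scaleN1r.
exists i; rewrite /octahedron_vertex.
by case: b; [right; rewrite scaleN1r|left; rewrite scale1r].
Qed.

Lemma octahedron_vertex_inj (R : realType) : injective (@octahedron_vertex R).
Proof.
move=> [i b] [j c] /rowP eq_ij; have := eq_ij i.
rewrite !mxE !eqxx /=; have [<-|_] := eqVneq i j; last first.
  by rewrite mulr1 mulr0 => /eqP; rewrite signr_eq0.
by rewrite !mulr1 => /signr_inj ->.
Qed.

Lemma card_Lambda3_1 (R : realType) : Lambda3_1 R #= `I_6.
Proof.
have -> : Lambda3_1 R =
    [set` [fset octahedron_vertex R t | t in {: 'I_3 * bool}]%fset].
  rewrite Lambda3_1E; apply/seteqP; split=> [_ [t _ <-]|x /imfsetP[t _ ->]].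
    by apply/imfsetP; exists t.
  by exists t.
apply/card_eq_fsetP; rewrite card_imfset; last exact: octahedron_vertex_inj.
by rewrite -cardT card_prod card_ord card_bool.
Qed.

(** * From finite families to arbitrary sets *)

Section EquilateralSet.
Variables (R : realType) (l : R) (P : set 'rV[R]_3).
Hypothesis l_gt0 : 0 < l.
Hypothesis P_dist : forall x y, P x -> P y -> x != y -> l1norm (x - y) = l.

Lemma equilateral_fset (A : {fset 'rV[R]_3}) :
    [set` A] `<=` P -> (4 < #|` A|)%N ->
  exists c : 'rV[R]_3, exists2 phi : A -> 'I_3 * bool, injective phi &
    #|` A| = 6%N -> forall p, val p = c + (l / 2) *: octahedron_vertex R (phi p).
Proof.
rewrite cardfE => AP; apply: equilateral_octahedron => // p q pq.
by apply: P_dist; [apply/AP/valP|apply/AP/valP|].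
Qed.

Lemma equilateral_fset_le6 (A : {fset 'rV[R]_3}) :
  [set` A] `<=` P -> (#|` A| <= 6)%N.
Proof.
move=> AP; have [//|A_gt4] := leqP #|` A| 4; first by move=> /leq_trans; apply.
have [_ [phi /leq_card + _]] := equilateral_fset AP A_gt4.
by rewrite card_prod card_ord card_bool cardfE.
Qed.

Lemma equilateral_finite : finite_set P.
Proof.
(* An infinite set would contain a finite subset with at least seven points. *)
apply: contrapT => /(infinite_set_fset 7)[A /equilateral_fset_le6 A6].
by rewrite leqNgt ltnS A6.
Qed.

Lemma equilateral_card_le6 : P #<= `I_6.
Proof.
have PE := fset_setK equilateral_finite.
have /card_eq_fsetP : #|` fset_set P| = #|` fset_set P| by [].
rewrite PE card_eq_le => /andP[P_le _]; apply: card_le_trans P_le _.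
by rewrite card_le_II; apply: equilateral_fset_le6; rewrite PE.
Qed.

Lemma equilateral6_similar : P #= `I_6 -> l1_similar P (Lambda3_1 R).
Proof.
move=> /card_fset_set P6; have sP : [set` fset_set P] `<=` P.
  by rewrite fset_setK //; exact: equilateral_finite.
have P_gt4 : (4 < #|` fset_set P|)%N by rewrite P6.
have [c [phi phi_inj /(_ P6) phiE]] := equilateral_fset sP P_gt4.
have [psi _ phiK] : bijective phi.
  by apply: inj_card_bij => //; rewrite card_prod card_ord card_bool -cardfE P6.
(* This inverts [c + (l / 2) *: _], the form of the points given by [phiE]. *)
exists ((fun x => (2 / l) *: x) \o (fun x => x + - c)).
  apply: l1_sim_comp; last exact: l1_sim_translation.
  by apply: l1_sim_dilation; rewrite divr_gt0.
have fE p : (2 / l) *: (val p - c) = octahedron_vertex R (phi p).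
  rewrite phiE addrC addKr scalerA mulrA divfK ?gt_eqF //.
  by rewrite divff ?scale1r ?pnatr_eq0.
rewrite Lambda3_1E; apply/seteqP; split=> [_ [x Px <-]|_ [t _ <-]] /=.
  have xP : x \in fset_set P.
    by rewrite in_fset_set; [exact/mem_set|exact: equilateral_finite].
  by exists (phi [` xP]%fset) => //; rewrite -fE.
exists (val (psi t)); last by rewrite /= fE phiK.
exact/sP/valP.
Qed.

End EquilateralSet.

Theorem theorem2p6 (R : realType) (P : set 'rV[R]_3)
    (hP : determines_single_distance P) :
  (P #<= `I_6) /\ ((P #= `I_6) <-> l1_similar P (Lambda3_1 R)).
Proof.
have [l l_gt0 P_dist] := single_distance_gt0 hP.
split; first exact: equilateral_card_le6 l_gt0 P_dist.
split; first exact: equilateral6_similar l_gt0 P_dist.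
move=> [f /l1_similarity_inj f_inj fP].
have := card_Lambda3_1 R; rewrite -fP; apply: card_eq_trans.
by rewrite card_eq_sym; apply: inj_card_eq => x y _ _ /f_inj.
Qed.
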